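(* Fix $\mathcal{A}\in\mathbb{R}^{n\times n\times p}$ and let $\bar{\mathcal{A}}=\frac{\mathcal{A}+\mathcal{A}^T}{2}$, with largest T-eigenvalue $\lambda_{\max}(\bar{\mathcal{A}})$ and smallest T-eigenvalue $\lambda_{\min}(\bar{\mathcal{A}})$. If $\alpha,\beta\in\mathbb{R}$ are any numbers satisfying $$\alpha\operatorname{tr}(\mathcal{B})\le\operatorname{tr}(\mathcal{A}*\mathcal{B})\le\beta\operatorname{tr}(\mathcal{B})$$ for every positive semidefinite tensor $\mathcal{B}\in\mathbb{R}^{n\times n\times p}$, then $\alpha\le\lambda_{\min}(\bar{\mathcal{A}})$ and $\lambda_{\max}(\bar{\mathcal{A}})\le\beta$. That is, $\lambda_{\min}(\bar{\mathcal{A}})$ and $\lambda_{\max}(\bar{\mathcal{A}})$ are the tightest bounds for the inequality: it holds for every positive semidefinite $\mathcal{B}$ with $\alpha=\lambda_{\min}(\bar{\mathcal{A}})$ and $\beta=\lambda_{\max}(\bar{\mathcal{A}})$, and no larger $\alpha$ and no smaller $\beta$ are possible.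
   Context: For a third-order tensor $\mathcal{A}$ of size $m\times n\times p$, its frontal slices are $A^{(k)}=\mathcal{A}(:,:,k)$, $k=1,\dots,p$. The block circulant matrix $\operatorname{bcirc}(\mathcal{A})$ is the $mp\times np$ matrix whose $(i,j)$ block ($1\le i,j\le p$) is $A^{(((i-j)\bmod p)+1)}$. $\operatorname{unfold}(\mathcal{A})$ is the $mp\times n$ matrix obtained by stacking $A^{(1)},\dots,A^{(p)}$ vertically, and $\operatorname{fold}$ is its inverse. The T-product of $\mathcal{A}$ (size $m\times n\times p$) and $\mathcal{B}$ (size $n\times s\times p$) is $\mathcal{A}*\mathcal{B}=\operatorname{fold}(\operatorname{bcirc}(\mathcal{A})\operatorname{unfold}(\mathcal{B}))$, of size $m\times s\times p$. The transpose $\mathcal{A}^T$ is obtained by transposing each frontal slice and reversing the order of slices $2,\dots,p$; $\mathcal{A}$ is symmetric if $\mathcal{A}=\mathcal{A}^T$. The T-eigenvalues of $\mathcal{A}\in\mathbb{R}^{n\times n\times p}$ are the eigenvalues of $\operatorname{bcirc}(\mathcal{A})$, all real when $\mathcal{A}$ is symmetric. A positive semidefinite real tensor is a symmetric tensor with $\operatorname{unfold}(\mathcal{X})^T\operatorname{bcirc}(\mathcal{A})\operatorname{unfold}(\mathcal{X})\ge 0$ for all $\mathcal{X}\in\mathbb{R}^{n\times1\times p}$, i.e. $\operatorname{bcirc}(\mathcal{A})$ is symmetric positive semidefinite. The trace of $\mathcal{A}$ of size $n\times n\times p$ is $\operatorname{tr}(\mathcal{A})=\sum_{k=1}^p\operatorname{tr}(\widehat{\mathcal{A}}^{(k)})$,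 where $\widehat{\mathcal{A}}$ is the discrete Fourier transform (unnormalized) of $\mathcal{A}$ along the third mode; equivalently $\operatorname{tr}(\mathcal{A})=\operatorname{tr}(\operatorname{bcirc}(\mathcal{A}))=p\operatorname{tr}(A^{(1)})$. *)

(* Defs.v *)
From HB Require Import structures.
From mathcomp Require Import all_boot all_order all_algebra.
From mathcomp Require Import complex.
From mathcomp Require Import all_classical all_reals all_analysis.

Set Implicit Arguments.
Unset Strict Implicit.
Unset Printing Implicit Defensive.

Import Order.TTheory GRing.Theory Num.Theory.
Local Open Scope classical_set_scope.
Local Open Scope ring_scope.
Local Open Scope complex_scope.

(* [A k] is the frontal slice A(:,:,k), counted from 0.  Finite functions give
   Leibniz extensionality and the pointwise lmodType structure. *)
Notation tensor R m n p := {ffun 'I_p -> 'M[R]_(m, n)}.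

(* The third dimension has the form p.+1, so that 'I_p.+1 is the additive group
   of integers mod p.+1: below, [i - j] and [- k] on slice indices are taken
   mod p.+1. *)

Definition bcirc (R : realType) (m n p : nat) (A : tensor R m n p.+1) :
    'M[R]_(\sum_(i < p.+1) m, \sum_(j < p.+1) n) :=
  \mxblock_(i < p.+1, j < p.+1) A (i - j).

Definition unfold (R : realType) (m n p : nat) (A : tensor R m n p.+1) :
    'M[R]_(\sum_(i < p.+1) m, n) :=
  \mxcol_(k < p.+1) A k.

Definition fold (R : realType) (m n p : nat)
    (M : 'M[R]_(\sum_(i < p.+1) m, n)) : tensor R m n p.+1 :=
  [ffun k => submxcol M k].

Definition tprod (R : realType) (m n s p : nat)
    (A : tensor R m n p.+1) (B : tensor R n s p.+1) : tensor R m s p.+1 :=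
  fold (bcirc A *m unfold B).

(* k |-> - k fixes slice 0 and reverses the order of slices 1, ..., p. *)
Definition ttrans (R : realType) (m n p : nat) (A : tensor R m n p.+1) :
    tensor R n m p.+1 :=
  [ffun k => (A (- k))^T].

Definition tsymmetric (R : realType) (n p : nat) (A : tensor R n n p.+1) : Prop :=
  A = ttrans A.

Definition tpsd (R : realType) (n p : nat) (A : tensor R n n p.+1) : Prop :=
  tsymmetric A /\
  forall X : tensor R n 1 p.+1,
    0 <= ((unfold X)^T *m bcirc A *m unfold X) ord0 ord0.

(* exp (- 2 pi i / p) *)
Definition dft_root (R : realType) (p : nat) : R[i] :=
  cos (2 * pi / p%:R) -i* sin (2 * pi / p%:R).

Definition dft (R : realType) (m n p : nat) (A : tensor R m n p.+1) :
    tensor R[i] m n p.+1 :=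
  [ffun k : 'I_p.+1 => \sum_(j < p.+1)
     dft_root R p.+1 ^+ (k * j) *: map_mx (real_complex R) (A j)].

(* A priori a complex number.  In R[i], x <= y means that x and y have the same
   imaginary part and 'Re x <= 'Re y. *)
Definition ttrace (R : realType) (n p : nat) (A : tensor R n n p.+1) : R[i] :=
  \sum_(k < p.+1) \tr (dft A k).

Definition teigenvalue (R : realType) (n p : nat) (A : tensor R n n p.+1)
    (z : R[i]) : Prop :=
  eigenvalue (map_mx (real_complex R) (bcirc A)) z.

(* The bound ranges over the whole complex spectrum, so a largest or smallest
   T-eigenvalue exists only if all T-eigenvalues are real, as they are when A is
   symmetric.  The default value 0 is returned only when there is none. *)
Definition tlambda_max (R : realType) (n p : nat) (A : tensor R n n p.+1) : R :=
  xget 0 [set l : R | teigenvalue A l%:C /\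
                      forall z : R[i], teigenvalue A z -> z <= l%:C].

Definition tlambda_min (R : realType) (n p : nat) (A : tensor R n n p.+1) : R :=
  xget 0 [set l : R | teigenvalue A l%:C /\
                      forall z : R[i], teigenvalue A z -> l%:C <= z].

Definition tsym_part (R : realType) (n p : nat) (A : tensor R n n p.+1) :
    tensor R n n p.+1 :=
  2^-1 *: (A + ttrans A).

Definition trace_bounds (R : realType) (n p : nat) (A : tensor R n n p.+1)
    (alpha beta : R) : Prop :=
  forall B : tensor R n n p.+1, tpsd B ->
    alpha%:C * ttrace B <= ttrace (tprod A B) <= beta%:C * ttrace B.

(* Main.v *)
(* The map bcirc is an injective *-morphism from tensors to matrices, and
   tr A = tr (bcirc A) because the powers of a nontrivial root of unity sum to 0.
   If B is positive semidefinite then tr (A * B) = tr (bcirc Abar *m bcirc B);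
   in an orthonormal eigenbasis of bcirc Abar this is a combination of the
   T-eigenvalues of Abar with nonnegative weights whose sum is tr B, which gives
   the two bounds.  Conversely an eigenvector of bcirc Abar for l folds into a
   tensor V with Abar * V = l V, and B = V * V^T satisfies
   tr (A * B) = l tr B with tr B > 0. *)

Require Import Defs.
From mathcomp Require Import all_boot all_order all_algebra.
From mathcomp Require Import complex.
From mathcomp Require Import all_classical all_reals all_analysis.
From mathcomp Require Import ring lra.
Set Implicit Arguments.
Unset Strict Implicit.
Unset Printing Implicit Defensive.

Import Order.TTheory GRing.Theory Num.Theory.
Local Open Scope ring_scope.
Local Open Scope complex_scope.
Local Open Scope sesquilinear_scope.

(** * Spectra and traces of real symmetric matrices, viewed over [R[i]] *)

Lemma conjC_map_real_complex (R : rcfType) m n (M : 'M[R]_(m, n)) :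
  map_mx Num.conj (map_mx (real_complex R) M) = map_mx (real_complex R) M.
Proof.
apply/matrixP => i j; rewrite !mxE; apply/CrealP.
by apply/complex_realP; exists (M i j).
Qed.

Lemma hermitian_map_real_complex (R : rcfType) n (M : 'M[R]_n) :
  M^T = M -> map_mx (real_complex R) M \is hermsymmx.
Proof.
move=> Msym; apply/is_hermitianmxP.
by rewrite expr0 scale1r map_trmx Msym conjC_map_real_complex.
Qed.

(** Write M = P^-1 D P. A left eigenvector v of M gives the left eigenvector v P^-1 of D, and a
    nonzero coordinate i of it forces a = D_ii. Conversely, row i of P is an eigenvector for
    D_ii. *)
Lemma eigenvalue_spectral_diag (C : numClosedFieldType) n (M : 'M[C]_n) a :
  M \is normalmx ->
  reflect (exists i, a = spectral_diag M 0 i) (eigenvalue M a).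
Proof.
move=> /orthomx_spectralP; set P := spectralmx M; set d := spectral_diag M.
have Pu : P \in unitmx := spectral_unit M.
move=> ME; apply: (iffP eigenvalueP) => [[v vM v0]|[i ->]].
- have wD : v *m invmx P *m diag_mx d = a *: (v *m invmx P).
    by rewrite scalemxAl -vM ME !mulmxA mulmxK.
  have /rV0Pn[i wi0] : v *m invmx P != 0.
    by apply: contra v0 => /eqP w0; rewrite -[v](mulmxKV Pu) w0 mul0mx.
  exists i; apply: (mulfI wi0); have /rowP/(_ i) := wD.
  by rewrite mul_mx_diag mxE [in RHS]mxE => ->; rewrite mulrC.
- exists (row i P).
    rewrite {1}ME rowE -!mulmxA mulKVmx // mulmxA.
    suff -> : delta_mx 0 i *m diag_mx d = d 0 i *: delta_mx 0 i :> 'rV_n.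
      by rewrite -scalemxAl.
    rewrite -rowE; apply/rowP => j; rewrite !mxE eqxx /=.
    by case: (eqVneq i j) => [->|ij]; rewrite ?mulr1 ?mulr0.
  apply/negP => /eqP r0; have : row i (P *m invmx P) = 0 by rewrite row_mul r0 mul0mx.
  rewrite mulmxV // => /rowP/(_ i); rewrite !mxE eqxx => /eqP.
  by rewrite oner_eq0.
Qed.

(** A Hermitian matrix has a real spectral diagonal, so taking real parts loses nothing and extrema
    can be sought in the total order of [R]. *)
Lemma eigenvalue_sym_real (R : rcfType) n (M : 'M[R]_n) (a : R[i]) : M^T = M ->
  reflect (exists i, a =
      (complex.Re (spectral_diag (map_mx (real_complex R) M) 0 i))%:C)
    (eigenvalue (map_mx (real_complex R) M) a).
Proof.
move=> /hermitian_map_real_complex Mh.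
have /mxOverP dreal := hermitian_spectral_diag_real Mh.
by apply: (iffP (eigenvalue_spectral_diag _ (hermitian_normalmx Mh))) => -[i ->];
  exists i; rewrite RRe_real.
Qed.

Lemma sym_min_eigenvalue (R : rcfType) n (M : 'M[R]_n) : (0 < n)%N -> M^T = M ->
  exists l : R, eigenvalue (map_mx (real_complex R) M) l%:C /\
    forall z, eigenvalue (map_mx (real_complex R) M) z -> l%:C <= z.
Proof.
move=> n0 Msym; set d := spectral_diag (map_mx (real_complex R) M).
case: (Order.TotalTheory.arg_minP (fun i => complex.Re (d 0 i))
  (erefl : predT (Ordinal n0))) => i _ imin.
exists (complex.Re (d 0 i)); split; first by apply/eigenvalue_sym_real => //; exists i.
by move=> z /(eigenvalue_sym_real _ Msym)[j ->]; rewrite lecR imin.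
Qed.

Lemma sym_max_eigenvalue (R : rcfType) n (M : 'M[R]_n) : (0 < n)%N -> M^T = M ->
  exists l : R, eigenvalue (map_mx (real_complex R) M) l%:C /\
    forall z, eigenvalue (map_mx (real_complex R) M) z -> z <= l%:C.
Proof.
move=> n0 Msym; set d := spectral_diag (map_mx (real_complex R) M).
case: (Order.TotalTheory.arg_maxP (fun i => complex.Re (d 0 i))
  (erefl : predT (Ordinal n0))) => i _ imax.
exists (complex.Re (d 0 i)); split; first by apply/eigenvalue_sym_real => //; exists i.
by move=> z /(eigenvalue_sym_real _ Msym)[j ->]; rewrite lecR; apply: imax.
Qed.

(** The eigenbasis used below is complex while positivity is assumed on real vectors only. With u =
    x + iy, the form splits as x B x^T + y B y^T because the cross terms cancel. *)
Lemma complex_psd_form (R : rcfType) n (B : 'M[R]_n) (u : 'rV[R[i]]_n) :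
  B^T = B -> (forall x : 'cV[R]_n, 0 <= (x^T *m B *m x) 0 0) ->
  0 <= (u *m map_mx (real_complex R) B *m u ^t*) 0 0.
Proof.
move=> Bsym Bpsd.
pose x : 'rV[R]_n := map_mx (@complex.Re R) u.
pose y : 'rV[R]_n := map_mx (@complex.Im R) u.
have uE : u = map_mx (real_complex R) x + 'i%C *: map_mx (real_complex R) y.
  by apply/rowP => k; rewrite !mxE -complexE.
have uJ : u ^t* = map_mx (real_complex R) x^T - 'i%C *: map_mx (real_complex R) y^T.
  rewrite uE linearD linearZ /= map_mxD map_mxZ !map_trmx !conjC_map_real_complex.
  by rewrite -scaleNr complexiE /= conjCi.
(* A 1 x 1 matrix equals its transpose. *)
have xy : x *m B *m y^T = y *m B *m x^T.
  transitivity (x *m B *m y^T)^T; first by apply/rowP => k; rewrite [RHS]mxE !ord1.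
  by rewrite !trmx_mul trmxK Bsym mulmxA.
have -> : u *m map_mx (real_complex R) B *m u ^t* =
    map_mx (real_complex R) (x *m B *m x^T + y *m B *m y^T).
  rewrite uJ {1}uE !(mulmxDl, mulmxBr) -!scalemxAl -!scalemxAr -!map_mxM xy.
  rewrite scalerA -expr2 sqr_i scaleN1r map_mxD opprB addrACA.
  by rewrite subrr addr0.
rewrite mxE ler0c mxE addr_ge0 //.
  by have := Bpsd x^T; rewrite trmxK.
by have := Bpsd y^T; rewrite trmxK.
Qed.

(** The weights are the diagonal entries of P B P^*, where the unitary P diagonalizes M. They are
    values of the form of B at the rows of P, and both trace formulas follow by cyclicity. *)
Lemma trace_mul_psd_spectral (R : rcfType) n (M B : 'M[R]_n) :
  M^T = M -> B^T = B -> (forall x : 'cV[R]_n, 0 <= (x^T *m B *m x) 0 0) ->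
  exists c : 'I_n -> R[i],
    [/\ forall i, 0 <= c i, (\tr B)%:C = \sum_i c i &
     (\tr (M *m B))%:C =
       \sum_i spectral_diag (map_mx (real_complex R) M) 0 i * c i].
Proof.
move=> Msym Bsym Bpsd; set MC := map_mx _ M; set BC := map_mx (real_complex R) B.
pose P := spectralmx MC.
have Pu : P \in unitmx := spectral_unit MC.
have PV : invmx P = P ^t* := invmx_unitary (spectral_unitarymx MC).
exists (fun i => (P *m BC *m P ^t*) i i); split.
- move=> i; have := complex_psd_form (row i P) Bsym Bpsd.
  congr (0 <= _); rewrite -!row_mul 2![LHS]mxE [RHS]mxE.
  by apply: eq_bigr => k _; rewrite !mxE.
- rewrite -/(\tr (P *m BC *m P ^t*)) mxtrace_mulC -PV mulKmx //.
  by rewrite trace_map_mx.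
rewrite -trace_map_mx map_mxM -/MC -/BC.
have /orthomx_spectralP := hermitian_normalmx (hermitian_map_real_complex Msym).
rewrite -/MC -/P => {1}->.
rewrite -!mulmxA mxtrace_mulC -!mulmxA PV mul_diag_mx.
by apply: eq_bigr => i _; rewrite mxE !mulmxA.
Qed.

Lemma mxtrace_mul_tr_gt0 (R : realDomainType) m n (M : 'M[R]_(m, n)) :
  M != 0 -> 0 < \tr (M *m M^T).
Proof.
have E i : (M *m M^T) i i = \sum_j M i j ^+ 2.
  by rewrite mxE; apply: eq_bigr => j _; rewrite mxE expr2.
have ge0 i : 0 <= (M *m M^T) i i by rewrite E sumr_ge0 // => j _; apply: sqr_ge0.
move=> M0; rewrite lt_def sumr_ge0 // andbT; apply: contra M0 => /eqP.
move=> /psumr_eq0P tr0; apply/eqP/matrixP => i j; rewrite mxE; apply/eqP.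
have := tr0 (fun i _ => ge0 i) i isT; rewrite E => /psumr_eq0P row0.
by rewrite -sqrf_eq0 row0 // => k _; apply: sqr_ge0.
Qed.

Section Tensors.
Variable R : realType.

(** * Tensors as block circulant matrices *)

Lemma foldK m n p : cancel (@unfold R m n p) (@fold R m n p).
Proof. by move=> A; apply/ffunP => k; rewrite ffunE mxcolK. Qed.

Lemma unfoldK m n p : cancel (@fold R m n p) (@unfold R m n p).
Proof.
move=> M; rewrite /unfold; under eq_mxcol do rewrite ffunE.
exact: submxcolK.
Qed.

Lemma unfold_tprod m n s p (A : tensor R m n p.+1) (B : tensor R n s p.+1) :
  unfold (tprod A B) = bcirc A *m unfold B.
Proof. exact: unfoldK. Qed.

Lemma tprodE m n s p (A : tensor R m n p.+1) (B : tensor R n s p.+1) k :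
  tprod A B k = \sum_j A (k - j) *m B j.
Proof. by rewrite ffunE mul_mxblock_mxrow mxcolK. Qed.

(** The first block column lists the slices. *)
Lemma bcirc_inj m n p : injective (@bcirc R m n p).
Proof.
move=> A B AB; apply/ffunP => k.
have := congr1 (fun M => submxblock M k 0) AB.
by rewrite /bcirc !mxblockK subr0.
Qed.

(** Block (i, k) of the matrix product is the sum of A(i - j) B(j - k) over j; shifting j by k turns
    it into the cyclic convolution at i - k. *)
Lemma bcirc_tprod m n s p (A : tensor R m n p.+1) (B : tensor R n s p.+1) :
  bcirc (tprod A B) = bcirc A *m bcirc B.
Proof.
rewrite [RHS]mul_mxblock; apply: eq_mxblock => i k.
rewrite tprodE [RHS](reindex_inj (addIr k)) /=.
by apply: eq_bigr => j _; rewrite addrK opprD [- j - k]addrC addrA.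
Qed.

Lemma bcirc_ttrans m n p (A : tensor R m n p.+1) :
  bcirc (ttrans A) = (bcirc A)^T.
Proof.
by rewrite tr_mxblock; apply: eq_mxblock => i j; rewrite ffunE opprB.
Qed.

Lemma bcircD m n p (A B : tensor R m n p.+1) : bcirc (A + B) = bcirc A + bcirc B.
Proof. by rewrite -mxblockD; apply: eq_mxblock => i j; rewrite ffunE. Qed.

Lemma bcircZ m n p a (A : tensor R m n p.+1) : bcirc (a *: A) = a *: bcirc A.
Proof. by apply/matrixP => i j; rewrite !mxE ffunE mxE. Qed.

Lemma unfoldZ m n p a (A : tensor R m n p.+1) : unfold (a *: A) = a *: unfold A.
Proof. by apply/matrixP => i j; rewrite !mxE ffunE mxE. Qed.

Lemma bcirc_tsym_part n p (A : tensor R n n p.+1) :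
  bcirc (tsym_part A) = 2^-1 *: (bcirc A + (bcirc A)^T).
Proof. by rewrite bcircZ bcircD bcirc_ttrans. Qed.

Lemma bcirc_tsym_part_sym n p (A : tensor R n n p.+1) :
  (bcirc (tsym_part A))^T = bcirc (tsym_part A).
Proof. by rewrite bcirc_tsym_part linearZ linearD /= trmxK [X in _ *: X]addrC. Qed.

(** Every column is the unfolding of a tensor, and [bcirc] is injective and turns [ttrans] into the
    matrix transpose. *)
Lemma tpsdP n p (B : tensor R n n p.+1) :
  tpsd B <-> (bcirc B)^T = bcirc B /\
    forall x : 'cV[R]_(\sum_(i < p.+1) n), 0 <= (x^T *m bcirc B *m x) 0 0.
Proof.
split=> [[Bsym Bpsd]|[Bsym Bpsd]]; split.
- by rewrite -bcirc_ttrans -Bsym.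
- by move=> x; have := Bpsd (fold x); rewrite unfoldK.
- by apply: bcirc_inj; rewrite bcirc_ttrans Bsym.
- by move=> X; apply: Bpsd.
Qed.

(** * Roots of unity and the trace *)

Lemma dft_rootX p k :
  dft_root R p ^+ k = cos (k%:R * (2 * pi / p%:R)) -i* sin (k%:R * (2 * pi / p%:R)).
Proof.
rewrite /dft_root; set t := 2 * pi / p%:R.
elim: k => [|k IH]; first by rewrite expr0 mul0r cos0 sin0 oppr0.
rewrite exprS IH -[k.+1]add1n natrD mulrDl mul1r cosD sinD.
by apply/eqP; rewrite eq_complex /=; apply/andP; split; apply/eqP; ring.
Qed.

Lemma dft_rootX_size p : dft_root R p.+1 ^+ p.+1 = 1.
Proof.
rewrite dft_rootX mulrC divfK ?pnatr_eq0 // mulr_natl cos2pi sin2pi.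
by rewrite oppr0.
Qed.

Lemma dft_rootX_neq1 p j : (0 < j < p.+1)%N -> dft_root R p.+1 ^+ j != 1.
Proof.
move=> /andP[j0 jp]; rewrite dft_rootX eq_complex /= negb_and; apply/orP; left.
(* Half the angle: 0 < x < pi gives sin x > 0, whereas cos 2x = 1 would force sin x = 0. *)
pose x := j%:R * (pi / p.+1%:R) : R.
have -> : j%:R * (2 * pi / p.+1%:R) = x *+ 2 :> R by rewrite /x; ring.
have /sin_gt0_pi sx : 0 < x < pi.
  rewrite /x mulr_gt0 ?ltr0n ?divr_gt0 ?pi_gt0 ?ltr0n //=.
  by rewrite mulrCA gtr_pMr ?pi_gt0 // ltr_pdivrMr ?ltr0n // mul1r ltr_nat.
rewrite cos_mulr2n cos2sin2; apply/negP => /eqP cx.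
have : sin x ^+ 2 = 0 by lra.
by move/eqP; rewrite sqrf_eq0 gt_eqF.
Qed.

Lemma dft_root_sum p (j : 'I_p.+1) :
  \sum_(k < p.+1) dft_root R p.+1 ^+ (k * j) = if j == 0 then p.+1%:R else 0.
Proof.
have [->|j0] := eqVneq j 0.
  under eq_bigr do rewrite muln0 expr0.
  by rewrite sumr_const card_ord.
under eq_bigr do rewrite mulnC exprM.
have w1 : dft_root R p.+1 ^+ j - 1 != 0.
  by rewrite subr_eq0 dft_rootX_neq1 // ltn_ord lt0n j0.
(* Geometric sum: multiplied by w^j - 1 it telescopes to w^(j(p+1)) - 1 = 0. *)
by apply: (mulfI w1); rewrite -subrX1 -exprM mulnC exprM dft_rootX_size
  expr1n subrr mulr0.
Qed.

(** Both sides equal p+1 times the trace of slice 0: it fills every diagonal block of [bcirc A], and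
    summing the transform over all frequencies cancels the other slices. *)
Lemma ttraceE n p (A : tensor R n n p.+1) : ttrace A = (\tr (bcirc A))%:C.
Proof.
rewrite mxtrace_mxblock; under [in RHS]eq_bigr do rewrite subrr.
rewrite sumr_const card_ord rmorphMn /=.
transitivity (\sum_(k < p.+1) \sum_(j < p.+1)
    dft_root R p.+1 ^+ (k * j) * (\tr (A j))%:C).
  apply: eq_bigr => k _; rewrite ffunE raddf_sum; apply: eq_bigr => j _.
  by rewrite /= mxtraceZ trace_map_mx.
rewrite exchange_big /=; under eq_bigr do rewrite -mulr_suml dft_root_sum.
rewrite (bigD1 0) //= big1 ?addr0 => [|j /negPf ->]; last by rewrite mul0r.
by rewrite mulr_natl.
Qed.

(** For symmetric B, tr (A^T B) = tr (B A) = tr (A B), so A may be replaced by its symmetric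
    part. *)
Lemma ttrace_tprod_sym n p (A B : tensor R n n p.+1) : (bcirc B)^T = bcirc B ->
  ttrace (tprod A B) = (\tr (bcirc (tsym_part A) *m bcirc B))%:C.
Proof.
move=> Bsym; rewrite ttraceE bcirc_tprod bcirc_tsym_part -scalemxAl mulmxDl.
rewrite mxtraceZ mxtraceD -[\tr (_^T *m _)]mxtrace_tr trmx_mul trmxK Bsym.
by rewrite [\tr (bcirc B *m _)]mxtrace_mulC; congr (_%:C); field.
Qed.

(** * Extremal T-eigenvalues and sharpness of the bounds *)

Lemma sum_slices_gt0 n p : (0 < \sum_(i < p.+1) n.+1)%N.
Proof. by rewrite sum_nat_const card_ord muln_gt0. Qed.

(** A symmetric matrix of positive order has a least eigenvalue, so [xget] returns it and not the
    default 0. *)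
Lemma tlambda_minP n p (A : tensor R n.+1 n.+1 p.+1) : (bcirc A)^T = bcirc A ->
  teigenvalue A (tlambda_min A)%:C /\
  forall z, teigenvalue A z -> (tlambda_min A)%:C <= z.
Proof.
by move=> /(sym_min_eigenvalue (sum_slices_gt0 n p)); apply: xgetPex.
Qed.

Lemma tlambda_maxP n p (A : tensor R n.+1 n.+1 p.+1) : (bcirc A)^T = bcirc A ->
  teigenvalue A (tlambda_max A)%:C /\
  forall z, teigenvalue A z -> z <= (tlambda_max A)%:C.
Proof.
by move=> /(sym_max_eigenvalue (sum_slices_gt0 n p)); apply: xgetPex.
Qed.

Lemma trace_bounds_tlambda n p (A : tensor R n.+1 n.+1 p.+1) :
  trace_bounds A (tlambda_min (tsym_part A)) (tlambda_max (tsym_part A)).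
Proof.
move=> B /tpsdP[Bsym Bpsd].
have Asym := bcirc_tsym_part_sym A.
rewrite ttrace_tprod_sym // ttraceE.
have [_ lmin] := tlambda_minP Asym.
have [_ lmax] := tlambda_maxP Asym.
have [c [c0 -> ->]] := trace_mul_psd_spectral Asym Bsym Bpsd.
have eig i : teigenvalue (tsym_part A)
    (spectral_diag (map_mx (real_complex R) (bcirc (tsym_part A))) 0 i).
  apply/eigenvalue_spectral_diag; last by exists i.
  exact/hermitian_normalmx/hermitian_map_real_complex.
(* As tr B is the sum of the weights, both bounds hold term by term. *)
rewrite !mulr_sumr; apply/andP; split; apply: ler_sum => i _.
  by rewrite ler_wpM2r ?c0 ?lmin.
by rewrite ler_wpM2r ?c0 ?lmax.
Qed.

Lemma trace_bounds_eigenvalue n p (A : tensor R n n p.+1) a b l :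
  trace_bounds A a b -> teigenvalue (tsym_part A) l%:C -> a <= l <= b.
Proof.
(* Since l and the matrix are real, the eigenvector v can be taken real, and so [V] is a real
   tensor. *)
rewrite /teigenvalue eigenvalue_map => AB /eigenvalueP[v vM v0].
pose V : tensor R n 1 p.+1 := fold v^T; pose B := tprod V (ttrans V).
have BE : bcirc B = bcirc V *m (bcirc V)^T by rewrite bcirc_tprod bcirc_ttrans.
have Bsym : (bcirc B)^T = bcirc B by rewrite BE trmx_mul trmxK.
(* v is a left eigenvector; by symmetry its transpose is a right one. *)
have AV : tprod (tsym_part A) V = l *: V.
  apply: (can_inj (@foldK n 1 p)); rewrite unfold_tprod unfoldZ unfoldK.
  by rewrite -(bcirc_tsym_part_sym A) -trmx_mul vM linearZ.
have B_gt0 : 0 < \tr (bcirc B).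
  rewrite BE mxtrace_mul_tr_gt0 //; apply: contra v0 => /eqP V0.
  have VE : V = 0 *: V by apply: bcirc_inj; rewrite bcircZ scale0r.
  by rewrite -[v]trmxK -[v^T]unfoldK -/V VE unfoldZ scale0r trmx0.
have /AB : tpsd B.
  (* The form at x is the sum of the squared entries of x^T [bcirc V]. *)
  apply/tpsdP; split=> // x; rewrite BE mulmxA -mulmxA.
  rewrite -[X in X *m _]trmxK trmx_mul trmxK mxE; apply: sumr_ge0 => i _.
  by rewrite mxE -expr2 sqr_ge0.
(* The middle trace becomes l tr B, and dividing by tr B > 0 leaves a <= l <= b. *)
rewrite ttrace_tprod_sym // ttraceE BE mulmxA -bcirc_tprod AV bcircZ -scalemxAl.
by rewrite -BE mxtraceZ -!rmorphM !lecR /= !ler_pM2r.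
Qed.

End Tensors.

Theorem theorem3p7 (R : realType) (n p : nat) (A : tensor R n.+1 n.+1 p.+1) :
  trace_bounds A (tlambda_min (tsym_part A)) (tlambda_max (tsym_part A)) /\
  (forall alpha beta : R, trace_bounds A alpha beta ->
     alpha <= tlambda_min (tsym_part A) /\ tlambda_max (tsym_part A) <= beta).
Proof.
have Asym := bcirc_tsym_part_sym A.
split=> [|a b AB]; first exact: trace_bounds_tlambda.
have [lmin _] := tlambda_minP Asym.
have [lmax _] := tlambda_maxP Asym.
have /andP[-> _] := trace_bounds_eigenvalue AB lmin.
by have /andP[_ ->] := trace_bounds_eigenvalue AB lmax.
Qed.
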